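(* Let $d\ge1$, let $h$ be the ballistic deposition process on $\mathbb{Z}^d$, and let $w(t,x):=h(t,x)-h(t,0)$. The Markov process $\{w(t,\cdot)\}_{t\ge0}$ on $\Omega=\mathbb{Z}^{\mathbb{Z}^d}$ has the Feller property, but is not strongly Feller.
   Context: Let $\Omega := \mathbb{Z}^{\mathbb{Z}^d}$ with the product topology ($\mathbb{Z}$ discrete) and its Borel $\sigma$-algebra; $e_1,\ldots,e_d$ are the standard basis vectors. Ballistic deposition: at each site $x\in\mathbb{Z}^d$ there is an independent Poisson clock of rate $1$ on $[0,\infty)$. Given an initial condition $h(0,\cdot)\in\Omega$, whenever the clock at $x$ rings at time $t$, the height at $x$ is instantaneously updated to $\max\{\max_{1\le i\le d}h(t,x\pm e_i),\,h(t,x)+1\}$ (inner maximum over all $i$ and both signs), which is the value of $h(s,x)$ for $s\in(t,t']$, $t'$ being the next ringing time at $x$. Precisely: for finite $D\subseteq\mathbb{Z}^d$ one performs only the updates at sites of $D$, in temporal order; the resulting heights are nondecreasing in $D$, and $h(t,x)$ is the limit as $D\uparrow\mathbb{Z}^d$, which is almost surely finite. The process $\{w(t,\cdot)\}_{t\ge0}$ is a time-homogeneous Markov process with transition semigroup $\{\mathcal{P}_t\}_{t\ge0}$: for bounded measurable $\Phi:\Omega\to\mathbb{R}$ and $f\in\Omega$, $\mathcal{P}_t\Phi(f)$ is the expected value of $\Phi(h(t,\cdot)-h(t,0))$ when the initial condition is $h(0,\cdot)=f$. Feller property: for every bounded continuous $\Phi:\Omega\to\mathbb{R}$ and every $t>0$,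 $\mathcal{P}_t\Phi$ is bounded and continuous. Strong Feller property: for every $t>0$, $\mathcal{P}_t$ maps bounded measurable functions to bounded continuous functions. *)

(* Defs.v *)
From HB Require Import structures.
From mathcomp Require Import all_boot all_order all_algebra finmap.
From mathcomp Require Import all_classical all_reals all_analysis.
From mathcomp Require summability.
Import Order.TTheory GRing.Theory Num.Theory.
Import numFieldNormedType.Exports.

Set Implicit Arguments.
Unset Strict Implicit.
Unset Printing Implicit Defensive.

Local Open Scope classical_set_scope.
Local Open Scope ring_scope.

(* Discrete topology on int, as the library does for nat. *)
HB.instance Definition _ := isPointed.Build int 0.
HB.instance Definition _ := hasNbhs.Build int principal_filter.
HB.instance Definition _ := Discrete_ofNbhs.Build int erefl.
HB.instance Definition _ := DiscreteUniform_ofNbhs.Build int.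
HB.instance Definition _ {R : numDomainType} :=
  @DiscretePseudoMetric_ofUniform.Build R int.

Definition mutually_independent (disp : measure_display)
    (T : measurableType disp) (R : realType) (P : probability T R)
    (I : choiceType) (F : I -> set (set T)) : Prop :=
  forall (J : {fset I}) (E : I -> set T), (forall i, i \in J -> F i (E i)) ->
    P (\bigcap_(i in [set` J]) E i) = (\prod_(i <- J) P (E i))%E.

(* Number of points of S in [a, b[; meaningful when S is locally finite, since
   fset_set sends infinite sets to the empty set. *)
Definition npoints (R : realType) (S : set R) (a b : R) : nat :=
  #|` fset_set (S `&` `[a, b[) |.

(* A Poisson process is given by the random locally finite set N w of its
   points in [0, +oo[. The strict inequality a < b in the third field excludes
   the parameter 0, on which poisson_pmf is not the Dirac mass at 0. *)
Record poisson_process (disp : measure_display) (T : measurableType disp)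
    (R : realType) (P : probability T R) (rate : R) (N : T -> set R) : Prop := {
  poisson_locally_finite : forall w,
    N w `<=` `[0, +oo[ /\ forall b, finite_set (N w `&` `[0, b[) ;
  poisson_measurable : forall a b : R, 0 <= a -> a < b ->
    measurable_fun [set: T] (fun w => npoints (N w) a b) ;
  poisson_law : forall (a b : R) (k : nat), 0 <= a -> a < b ->
    P [set w | npoints (N w) a b = k] = (poisson_pmf (rate * (b - a)) k)%:E ;
  poisson_independent_increments : forall s : nat -> R,
    0 <= s 0%N -> (forall i, s i <= s i.+1) ->
    mutually_independent P (fun i => preimage_set_system [set: T]
      (fun w => npoints (N w) (s i) (s i.+1)) measurable) }.

Definition points_sigma_algebra (T : Type) (R : realType) (N : T -> set R) :
    set (set T) :=
  <<s [set A | exists (a b : R) (k : nat),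
         0 <= a /\ A = [set w | npoints (N w) a b = k]] >>.

Definition poisson_clocks (disp : measure_display) (T : measurableType disp)
    (R : realType) (P : probability T R) (d : nat)
    (clock : 'rV[int]_d -> T -> set R) : Prop :=
  (forall x, poisson_process P 1 (clock x)) /\
  mutually_independent P (fun x => points_sigma_algebra (clock x)).

Definition config (d : nat) : Type := {ptws 'rV[int]_d -> int}.
HB.instance Definition _ (d : nat) := Topological.on (config d).
HB.instance Definition _ (d : nat) :=
  isPointed.Build (config d) (fun=> 0).

(* Deterministic dynamics: ring x is the set of ringing times of the clock at
   x. Sites ringing at the same time are updated simultaneously; almost surely
   this does not happen. *)
Definition update (R : realType) (d : nat) (ring : 'rV[int]_d -> set R)
    (D : {fset 'rV[int]_d}) (h : config d) (s : R) : config d :=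
  fun x => if (x \in D) && (s \in ring x) then
    \big[Num.max/h x + 1]_(i < d)
      Num.max (h (x + 'e_i)) (h (x - 'e_i))
  else h x.

(* The height at time t is the one before a possible update at time t, hence
   the half-open interval. *)
Definition ringing_times (R : realType) (d : nat) (ring : 'rV[int]_d -> set R)
    (D : {fset 'rV[int]_d}) (t : R) : seq R :=
  sort <=%R (fset_set (\bigcup_(x in [set` D]) (ring x `&` `[0, t[))).

Definition height_on (R : realType) (d : nat) (ring : 'rV[int]_d -> set R)
    (D : {fset 'rV[int]_d}) (t : R) (f : config d) : config d :=
  foldl (update ring D) f (ringing_times ring D t).

(* summability.totally is the filter of the finite sets directed by inclusion.
   When the heights are unbounded in D, which has probability 0, lim returns an
   arbitrary integer. *)
Definition height (R : realType) (d : nat) (ring : 'rV[int]_d -> set R)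
    (t : R) (f : config d) : config d :=
  fun x => lim ((fun D => height_on ring D t f x) @ summability.totally).

Definition bd_semigroup (disp : measure_display) (T : measurableType disp)
    (R : realType) (P : probability T R) (d : nat)
    (clock : 'rV[int]_d -> T -> set R)
    (t : R) (Phi : config d -> R) (f : config d) : R :=
  fine 'E_P[fun w => let h := height (clock^~ w) t f in
                     Phi (fun x => h x - h 0)].

Definition borel_measurable (R : realType) (E : ptopologicalType)
    (Phi : E -> R) : Prop :=
  measurable_fun [set: g_sigma_algebraType (@open E)] Phi.

Definition feller (R : realType) (E : ptopologicalType)
    (Q : R -> (E -> R) -> E -> R) : Prop :=
  forall (Phi : E -> R) (t : R), 0 < t ->
    bounded_fun Phi -> continuous Phi ->
    bounded_fun (Q t Phi) /\ continuous (Q t Phi).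

Definition strongly_feller (R : realType) (E : ptopologicalType)
    (Q : R -> (E -> R) -> E -> R) : Prop :=
  forall (Phi : E -> R) (t : R), 0 < t ->
    bounded_fun Phi -> borel_measurable Phi ->
    bounded_fun (Q t Phi) /\ continuous (Q t Phi).

(* Main.v *)
Require Import Defs.
From mathcomp Require Import all_boot all_order all_algebra finmap.
From mathcomp Require Import all_classical all_reals all_analysis.
From mathcomp Require Import measurable_realfun lra zify.
From mathcomp Require summability.
Import Order.TTheory GRing.Theory Num.Theory.
Import numFieldNormedType.Exports.
Set Implicit Arguments.
Unset Strict Implicit.
Unset Printing Implicit Defensive.
Local Open Scope classical_set_scope.
Local Open Scope ring_scope.

(* Feller: cut [0, t[ into slabs so short that the sites ringing during one
   slab form a subcritical percolation.  Their clusters are almost surely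
   finite, so that going backwards through the slabs the height at a site at
   time t depends on the initial heights at finitely many sites only.  Hence if
   f_n -> f pointwise the heights started from f_n converge almost surely, and
   dominated convergence applies.

   Not strongly Feller: take M_k with P(h(t, x_k) >= M_k) <= 2^-k for the flat
   initial condition, where x_k = (k, ..., k), and let Phi be the indicator of
   {g | g(x_k) >= M_k eventually}.  Then P_t Phi vanishes at the flat
   configuration, but equals 1 at configurations that are at least M_k + k at
   x_k for all large k, because heights never decrease; such configurations
   exist in every neighbourhood of the flat one. *)

(** * Finite-range dependence of the dynamics *)

Definition neighbour (d : nat) (u : 'I_d * bool) (y : 'rV[int]_d) : 'rV[int]_d :=
  if u.2 then y + 'e_u.1 else y - 'e_u.1.

(** Here [A] stands for the sites that ring. Only these look at their neighbours, so the heights on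
    a closed [S] after an update are determined by the heights on [S] before it. *)
Definition closed_on (d : nat) (A S : set 'rV[int]_d) : Prop :=
  forall y u, S y -> A y -> S (neighbour u y).

Section dynamics.
Context {R : realType} {d : nat}.
Implicit Types (ring : 'rV[int]_d -> set R) (D : {fset 'rV[int]_d}).
Implicit Types (f g : config d) (s t : R).

Lemma update_agree ring D D' f g s (S : set 'rV[int]_d) :
  closed_on [set y | ring y s] S ->
  (forall y, S y -> (y \in D) = (y \in D')) ->
  (forall y, S y -> f y = g y) ->
  forall y, S y -> update ring D f s y = update ring D' g s y.
Proof.
move=> Scl DD' fg y Sy; rewrite /update DD' //.
case: ifPn => [/andP[_ /set_mem yS]|_]; last exact: fg.
have nb b (i : 'I_d) := fg _ (Scl y (i, b) Sy yS).
rewrite fg //; apply: eq_bigr => i _.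
by have /= -> := nb true i; have /= -> := nb false i.
Qed.

Lemma update_id ring D f s :
  (forall y, y \in D -> ~ ring y s) -> update ring D f s = f.
Proof.
move=> Ds; apply/funext => y; rewrite /update; case: ifPn => // /andP[yD].
by move=> /set_mem /(Ds _ yD).
Qed.

Lemma update_ge ring D f s y : f y <= update ring D f s y.
Proof.
rewrite /update; case: ifPn => // _.
by rewrite (le_trans _ (bigmax_ge_id _ _ _ _)) // lerDl.
Qed.

Lemma foldl_update_ge ring D f (l : seq R) y :
  f y <= foldl (update ring D) f l y.
Proof.
elim: l f => //= s l IHl f.
exact: le_trans (update_ge ring D f s y) (IHl _).
Qed.

(** Allows updates without effect to be inserted or dropped: times at which no site of [D] rings,
    and empty cells of a time grid. *)
Lemma foldl_filter_id (X : Type) (Y : eqType) (op : X -> Y -> X) (p : pred Y)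
    (l : seq Y) (x : X) :
  (forall x y, y \in l -> ~~ p y -> op x y = x) ->
  foldl op x [seq y <- l | p y] = foldl op x l.
Proof.
elim: l x => //= y l IHl x opid.
have {}IHl z : foldl op z [seq y <- l | p y] = foldl op z l.
  by apply: IHl => x' y' y'l; apply: opid; rewrite inE y'l orbT.
by case: ifPn => /= py; rewrite IHl // opid // mem_head.
Qed.

(* The sites on which the heights at time t in a given set depend, as a
   function of the time at which they are needed. *)
Definition dependency_family ring t (S : R -> set 'rV[int]_d) : Prop :=
  (forall s s', 0 <= s -> s <= s' -> s' <= t -> S s' `<=` S s) /\
  (forall s, 0 <= s -> s < t -> closed_on [set y | ring y s] (S s)).

(** Induction forward in time: agreement on [S s0] restricts to the smaller set [S s] at the next
    update time [s], and closedness of [S s] carries it through that update. *)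
Lemma foldl_update_agree ring t (S : R -> set 'rV[int]_d) D D' f g l :
  dependency_family ring t S -> 0 <= t ->
  (forall y, S 0 y -> (y \in D) = (y \in D')) ->
  (forall y, S 0 y -> f y = g y) ->
  sorted <=%R l -> (forall s, s \in l -> 0 <= s < t) ->
  forall y, S t y ->
    foldl (update ring D) f l y = foldl (update ring D') g l y.
Proof.
move=> [Santi Scl] t0 DD' fg lsort lt0.
suff: forall s0, 0 <= s0 -> s0 <= t -> (forall y, S s0 y -> f y = g y) ->
    path <=%R s0 l -> forall y, S t y ->
    foldl (update ring D) f l y = foldl (update ring D') g l y.
  apply; first exact: (lexx 0).
  - by [].
  - exact: fg.
  - by case: l lsort lt0 => //= s l -> /(_ s (mem_head _ _)) /andP[->].
move: lt0 {lsort}; elim: l f g {fg} => [|s l IHl] f g lt0 s0 s00 s0t fg /=.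
  by move=> _ y Sy; apply: fg; exact: (Santi s0 t).
move=> /andP[s0s sl]; have /andP[s_0 s_t] := lt0 _ (mem_head _ _).
apply: (IHl _ _ _ s) => //.
- by move=> s' s'l; apply: lt0; rewrite inE s'l orbT.
- exact: ltW.
- apply: update_agree; first exact: Scl.
  + by move=> y Sy; apply: DD'; apply: (Santi 0 s) => //; exact: ltW.
  + by move=> y Sy; apply: fg; apply: (Santi s0 s) => //; exact: ltW.
Qed.

Definition locally_finite ring : Prop :=
  forall y, ring y `<=` `[0, +oo[ /\ forall b, finite_set (ring y `&` `[0, b[).

Section locally_finite_clocks.
Variables (ring : 'rV[int]_d -> set R) (ringf : locally_finite ring).

Lemma mem_ringing_times D t s :
  s \in ringing_times ring D t <->
  0 <= s < t /\ exists2 y, y \in D & ring y s.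
Proof.
rewrite mem_sort in_fset_set; last first.
  by apply: bigcup_finite => // y _; have [_] := ringf y; exact.
split=> [/set_mem[y yD [ys]]|[st [y yD ys]]].
  by rewrite /= in_itv /= => st; split=> //; exists y.
by apply/mem_set; exists y => //; split => //=; rewrite in_itv.
Qed.

Lemma ringing_times_sorted D t : sorted <%R (ringing_times ring D t).
Proof.
rewrite lt_sorted_uniq_le sort_uniq fset_uniq /=.
by apply: sort_sorted; exact: le_total.
Qed.

Lemma height_on_superset D t f (l : seq R) :
  sorted <%R l -> {subset ringing_times ring D t <= l} ->
  (forall s, s \in l -> 0 <= s < t) ->
  height_on ring D t f = foldl (update ring D) f l.
Proof.
move=> lsort Dl lt0; rewrite /height_on.
rewrite -(@foldl_filter_id _ _ _ (mem (ringing_times ring D t)) l).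
  congr foldl; apply: lt_sorted_eq; first exact: ringing_times_sorted.
    by apply: sorted_filter lsort; exact: lt_trans.
  move=> s; rewrite mem_filter inE.
  by case: (boolP (s \in _)) => //= /Dl ->.
move=> h s /lt0 st /negP sD; apply: update_id => y yD ys; apply: sD.
by apply/mem_ringing_times; split=> //; exists y.
Qed.

Lemma height_on_agree t (S : R -> set 'rV[int]_d) D D' f g :
  dependency_family ring t S -> 0 <= t ->
  (forall y, S 0 y -> (y \in D) = (y \in D')) ->
  (forall y, S 0 y -> f y = g y) ->
  forall y, S t y -> height_on ring D t f y = height_on ring D' t g y.
Proof.
move=> Sdep t0 DD' fg y Sy.
(* [D] and [D'] may have different ringing times, so both evolutions are run along the times of
   their union. *)
have lt0 s : s \in ringing_times ring (D `|` D')%fset t -> 0 <= s < t.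
  by move=> /mem_ringing_times[].
have lsort := ringing_times_sorted (D `|` D')%fset t.
have sub E : {subset E <= (D `|` D')%fset} ->
    {subset ringing_times ring E t <= ringing_times ring (D `|` D')%fset t}.
  move=> ED s /mem_ringing_times[st [z zE zs]]; apply/mem_ringing_times.
  by split=> //; exists z => //; exact: ED.
rewrite (height_on_superset _ lsort) ?(height_on_superset _ lsort) //.
- apply: foldl_update_agree Sdep _ _ _ _ _ y Sy => //.
  by move: lsort; rewrite lt_sorted_uniq_le => /andP[].
- by apply: sub => z zD; rewrite inE zD orbT.
- by apply: sub => z zD; rewrite inE zD.
Qed.

(** The net of heights is constant beyond [D], because every larger finite set also contains all of
    [S 0]. *)
Lemma height_near t (S : R -> set 'rV[int]_d) D f y :
  dependency_family ring t S -> 0 <= t -> S t y ->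
  (forall z, S 0 z -> z \in D) ->
  height ring t f y = height_on ring D t f y.
Proof.
move=> Sdep t0 Sy SD.
apply: (@lim_near_cst _ _ _ _ summability.totally_filter).
  exact: discrete_hausdorff.
exists D => // D' /= DD'; apply: (height_on_agree Sdep) => // z /SD zD.
by rewrite zD; apply: (fsubsetP DD').
Qed.

End locally_finite_clocks.
End dynamics.

(** * Clusters of active sites and dependency sets built from them *)

Section clusters.
Context {R : realType} {d : nat}.
Implicit Types (A S : set 'rV[int]_d) (y : 'rV[int]_d) (u : seq ('I_d * bool)).

(** [scanl] omits its starting value, so the sites visited are [y :: walk y u]. *)
Definition walk y u : seq 'rV[int]_d := scanl (fun z a => neighbour a z) y u.

Lemma take_walk y u k : walk y (take k u) = take k (walk y u).
Proof. by elim: u y k => [|a u IHu] y [|k] //=; rewrite -IHu. Qed.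

Lemma walk_rcons y u a :
  walk y (rcons u a) = rcons (walk y u) (neighbour a (last y (walk y u))).
Proof. by elim: u y => //= b u IHu y; rewrite -IHu. Qed.

(** Paths are self-avoiding so that the clocks along them are independent. *)
Definition active_path A y u : Prop :=
  uniq (y :: walk y u) /\ forall z, z \in y :: walk y u -> A z.

Lemma active_path_take A y u k : active_path A y u -> active_path A y (take k u).
Proof.
rewrite /active_path take_walk -[y :: take _ _]/(take k.+1 (y :: walk y u)).
by move=> [uu Au]; split=> [|z /mem_take/Au//]; exact: take_uniq.
Qed.

(** The witness is [y] with all neighbours of endpoints of active paths of fewer than [n] steps: the
    cluster and its outer boundary. As no active path has exactly [n] steps, a one-step extension of
    a short active path is short again if it is active. *)
Lemma cluster_closed A y n :
  (forall u, size u = n -> ~ active_path A y u) ->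
  exists S, [/\ finite_set S, S y & closed_on A S].
Proof.
move=> An; pose E := [set u : seq ('I_d * bool) | (size u < n)%N].
exists (y |` [set neighbour a (last y (walk y u))
              | a in setT & u in E `&` active_path A y]); split.
- rewrite finite_setU; split; first exact: finite_set1.
  apply: finite_image2; first exact: finite_finset.
  apply: finite_setIl; have -> : E =
      \bigcup_(k in `I_n) [set tval u | u in [set: k.-tuple ('I_d * bool)]].
    apply/seteqP; split=> [u un|_ [k kn [u _ <-]]]; last by rewrite /E /= size_tuple.
    by exists (size u) => //; exists (in_tuple u).
  apply: bigcup_finite => [|k _]; first exact: finite_II.
  by apply: finite_image; exact: finite_finset.
- by left.
- move=> z a; rewrite /setU /= => zS Az; right.
  suff [u [un Au zu]] : exists u, [/\ (size u < n)%N, active_path A y u &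
      last y (walk y u) = z] by exists a => //; exists u => //; rewrite zu.
  have short u : (size u <= n)%N -> active_path A y u -> (size u < n)%N.
    rewrite leq_eqVlt => /orP[/eqP un|//]; by move/An: un.
  case: zS => [zy|[b _ [u [un Au]] zE]].
    exists [::]; rewrite zy in Az *; split=> //; last first.
      by split=> // z'; rewrite inE => /eqP ->.
    by apply: short => //; split=> // z'; rewrite inE => /eqP ->.
  (* If the path already visits [z], it is cut there; otherwise the step [b] is appended and the
     path stays self-avoiding. *)
  have [zu|zu] := boolP (z \in y :: walk y u).
    have : (index z (y :: walk y u) <= size u)%N.
      by rewrite -ltnS -(size_scanl (fun z a => neighbour a z) y) index_mem.
    have := nth_index y zu; move: (index _ _) => i iz iu.
    exists (take i u); split.
    - by apply: leq_ltn_trans un; rewrite size_takel.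
    - exact: active_path_take.
    - rewrite take_walk (last_nth y) size_takel ?size_scanl //.
      by case: i iz iu => //= i iz iu; rewrite nth_take.
  have wE : walk y (rcons u b) = rcons (walk y u) z by rewrite walk_rcons zE.
  have Aub : active_path A y (rcons u b).
    case: Au => uu Au; split=> [|z']; rewrite wE -rcons_cons.
      by rewrite rcons_uniq zu.
    by rewrite mem_rcons inE => /orP[/eqP ->|/Au].
  exists (rcons u b); split=> //; last by rewrite wE last_rcons.
  by apply: short => //; rewrite size_rcons.
Qed.

Lemma closed_on_bigcup (I : Type) (D : set I) A (F : I -> set 'rV[int]_d) :
  (forall i, D i -> closed_on A (F i)) -> closed_on A (\bigcup_(i in D) F i).
Proof.
by move=> FA y a [i Di Fy] Ay; exists i => //; exact: FA Di _ _ Fy Ay.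
Qed.

Definition active (ring : 'rV[int]_d -> set R) (a b : R) : set 'rV[int]_d :=
  [set y | exists2 s, ring y s & a <= s < b].

(** Induction that peels off the last slab: [X] is enlarged to a finite set [Y] closed for all sites
    active in that slab, and the earlier slabs are treated with [Y] as target. *)
Lemma dependency_family_slabs (ring : 'rV[int]_d -> set R) (dl : R) (K : nat) :
  0 <= dl ->
  (forall k y, (k < K)%N -> exists S, [/\ finite_set S, S y &
     closed_on (active ring (dl *+ k) (dl *+ k.+1)) S]) ->
  forall X : set 'rV[int]_d, finite_set X -> exists S : R -> set 'rV[int]_d,
    [/\ dependency_family ring (dl *+ K) S, X `<=` S (dl *+ K) &
        finite_set (S 0)].
Proof.
move=> dl0; elim: K => [|K IHK] cl X Xfin.
  exists (fun=> X); split=> //; split=> [s s' _ _ _ //|s s0].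
  by rewrite mulr0n ltNge s0.
have /choice[F FP] y := cl K y (ltnSn K).
pose Y := \bigcup_(x in X) F x.
have Yfin : finite_set Y.
  by apply: bigcup_finite => // x _; have [] := FP x.
have Ycl : closed_on (active ring (dl *+ K) (dl *+ K.+1)) Y.
  by apply: closed_on_bigcup => x _; have [] := FP x.
have XY : X `<=` Y by move=> x Xx; exists x => //; have [] := FP x.
have [|S [[Santi Scl] YS S0]] := IHK _ Y Yfin.
  by move=> k y kK; apply: cl; rewrite ltnS ltnW.
exists (fun s => if s < dl *+ K then S s else Y); split; last 2 first.
- by rewrite ltNge ler_wpMn2l.
- by case: ifP.
split=> [s s' s0 ss' s't|s s0 st].
  have [s'K|Ks'] := ltP s' (dl *+ K).
    by rewrite (le_lt_trans ss' s'K); apply: Santi => //; exact: ltW.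
  case: ifPn => [sK z /YS|_]; last exact: subset_refl.
  by apply: Santi => //; exact: ltW.
case: ltP => [sK|Ks]; first exact: Scl.
by move=> y a Yy ys; apply: Ycl => //; exists s => //; rewrite Ks.
Qed.

End clusters.

(** * Almost sure finiteness of the clusters *)

Section clocks.
Context {disp : measure_display} {T : measurableType disp} {R : realType}.
Context (P : probability T R) {d : nat} (clock : 'rV[int]_d -> T -> set R).
Hypothesis hclock : poisson_clocks P clock.

Lemma clock_locally_finite w : locally_finite (clock^~ w).
Proof. by move=> y; exact: poisson_locally_finite (hclock.1 y) w. Qed.

(** Local finiteness rules out that [npoints] vanishes by its default value on infinite sets. *)
Lemma active_npoints w y (a b : R) : 0 <= a ->
  active (clock^~ w) a b y <-> npoints (clock y w) a b <> 0%N.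
Proof.
move=> a0; have fin : finite_set (clock y w `&` `[a, b[).
  have [_ /(_ b)] := clock_locally_finite w y; apply: sub_finite_set.
  apply: setIS => s /=; rewrite !in_itv /= => /andP[as_ ->].
  by rewrite (le_trans a0).
split=> [[s ys sab] /eqP|n0].
  rewrite cardfs_eq0 => /eqP /(fset_set_set0 fin) E.
  suff : (clock y w `&` `[a, b[) s by rewrite E.
  by split=> //=; rewrite in_itv.
apply: contrapT => na; apply: n0; rewrite /npoints.
suff -> : clock y w `&` `[a, b[ = set0 by rewrite fset_set0.
rewrite -subset0 => s [ys /=]; rewrite in_itv /= => sab.
by apply: na; exists s.
Qed.

Lemma measurable_npoints y (a b : R) (k : nat) : 0 <= a -> a < b ->
  measurable [set w | npoints (clock y w) a b = k].
Proof.
move=> a0 ab; rewrite -[X in measurable X]setTI.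
by apply: (poisson_measurable (hclock.1 y) a0 ab measurableT (Y := [set k])).
Qed.

Lemma active_setE y (a b : R) : 0 <= a ->
  [set w | active (clock^~ w) a b y] = ~` [set w | npoints (clock y w) a b = 0%N].
Proof. by move=> a0; apply/seteqP; split=> w /(active_npoints w y b a0). Qed.

Lemma measurable_active y (a b : R) : 0 <= a -> a < b ->
  measurable [set w | active (clock^~ w) a b y].
Proof.
by move=> a0 ab; rewrite active_setE //; exact/measurableC/measurable_npoints.
Qed.

Lemma probability_active y (a b : R) : 0 <= a -> a < b ->
  P [set w | active (clock^~ w) a b y] = (1 - expR (a - b))%:E.
Proof.
move=> a0 ab; rewrite active_setE // probability_setC; last first.
  exact: measurable_npoints.
rewrite (poisson_law (hclock.1 y)) // /poisson_pmf mul1r subr_gt0 ab.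
by rewrite expr0 fact0 invr1 !mul1r opprB.
Qed.

(** Independence of the clocks gives a product of factors 1 - exp(-(b - a)), each at most b - a. *)
Lemma probability_all_active (X : {fset 'rV[int]_d}) (a b : R) :
  0 <= a -> a < b ->
  (P (\bigcap_(y in [set` X]) [set w | active (clock^~ w) a b y]) <=
   ((b - a) ^+ #|` X|)%:E)%E.
Proof.
move=> a0 ab; rewrite (hclock.2 X) => [|y _]; last first.
  rewrite active_setE //; apply: sigma_algebraC; apply: sub_sigma_algebra.
  by exists a, b, 0%N.
under eq_bigr do rewrite probability_active //.
rewrite prodEFin lee_fin.
have -> : \prod_(i <- X) (1 - expR (a - b)) = (1 - expR (a - b)) ^+ #|` X|.
  by rewrite big_const_seq count_predT iter_mulr_1.
apply: lerXn2r; rewrite ?nnegrE ?subr_ge0.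
- by rewrite -expR0 ler_expR subr_le0 ltW.
- exact: ltW.
- by rewrite lerBlDr -lerBlDl -opprB addrC; have := expR_ge1Dx (a - b); lra.
Qed.

End clocks.

Lemma le0_geometric (R : realType) (p c : R) :
  (forall n, p <= c * 2^-1 ^+ n) -> p <= 0.
Proof.
move=> pc; have h : geometric c 2^-1 @ \oo --> (0 : R).
  by apply: cvg_geometric; rewrite ger0_norm ?invf_lt1 ?invr_ge0 ?ltr1n.
rewrite -(cvg_lim (@Rhausdorff R) h).
by apply: limr_ge; [apply: cvgP h|exact: nearW].
Qed.

Lemma ae_forall_countable (disp : measure_display) (T : measurableType disp)
    (R : realType) (mu : {measure set T -> \bar R}) (I : countType)
    (Q : I -> T -> Prop) :
  (forall i, \forall w \ae mu, Q i w) -> \forall w \ae mu, forall i, Q i w.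
Proof.
move=> Qi; suff : \forall w \ae mu, forall n : nat,
    if @choice.unpickle I n is Some i then Q i w else True.
  by apply: filterS => w Qw i; have := Qw (choice.pickle i); rewrite choice.pickleK.
by apply: ae_foralln => n; case: choice.unpickle => [i|]; [exact: Qi|exact: aeW].
Qed.

Section finite_clusters.
Context {disp : measure_display} {T : measurableType disp} {R : realType}.
Context (P : probability T R) {d : nat} (clock : 'rV[int]_d -> T -> set R).
Hypothesis hclock : poisson_clocks P clock.

(** A self-avoiding path with [size u] steps has one more site than steps, whence the exponent; if
    the walk revisits a site, the event is empty. *)
Lemma active_path_event y u (a b : R) : 0 <= a -> a < b ->
  let E := [set w | active_path (active (clock^~ w) a b) y u] in
  measurable E /\ (P E <= ((b - a) ^+ (size u).+1)%:E)%E.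
Proof.
move=> a0 ab E; have [uu|nuu] := boolP (uniq (y :: walk y u)); last first.
  have -> : E = set0.
    by rewrite -subset0 => w [uu _]; rewrite uu in nuu.
  by split; rewrite // measure0 lee_fin exprn_ge0 // subr_ge0 ltW.
pose X := seq_fset tt (y :: walk y u).
have XE z : (z \in X) = (z \in y :: walk y u) by exact: seq_fsetE.
have -> : E = \bigcap_(z in [set` X]) [set w | active (clock^~ w) a b z].
  apply/seteqP; split=> w wA.
    by move=> z zX; apply: wA.2; rewrite -XE.
  by split=> // z; rewrite -XE => zX; exact: wA.
split; first by apply: fin_bigcap_measurable => // z _; exact: (measurable_active hclock).
apply: le_trans (probability_all_active hclock _ a0 ab) _.
by rewrite size_seq_fset undup_id //= size_scanl.
Qed.

(** First-moment bound: there are (2d)^n words of length n, so an active path of n steps exists with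
    probability at most (b - a) (2d (b - a))^n, hence at most (b - a) 2^-n. *)
Lemma ae_cluster_closed y (a b : R) : 0 <= a -> a < b ->
  (d * 2)%:R * (b - a) <= 2^-1 ->
  \forall w \ae P, exists S : set 'rV[int]_d,
    [/\ finite_set S, S y & closed_on (active (clock^~ w) a b) S].
Proof.
move=> a0 ab dab.
pose E u := [set w | active_path (active (clock^~ w) a b) y u].
(* [N] says that active paths of every length start at [y]; outside [N] some length is missing and
   [cluster_closed] applies. *)
pose N := \bigcap_n \bigcup_(u in [set: n.-tuple ('I_d * bool)]) E u.
have mE u : measurable (E u) by have [] := active_path_event y u a0 ab.
have mU n : measurable (\bigcup_(u in [set: n.-tuple ('I_d * bool)]) E u).
  by apply: fin_bigcup_measurable => // u _; exact: mE.
have mN : measurable N by exact: bigcapT_measurable.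
exists N; split=> //; last first.
  move=> w /= nS n _; apply: contrapT => nE; apply: nS.
  apply: (@cluster_closed _ _ _ n) => u un Au; apply: nE.
  by exists (tcast un (in_tuple u)) => //; rewrite /E /= val_tcast.
have PN : P N \is a fin_num by exact: fin_num_measure.
suff : (P N <= 0)%E by rewrite measure_le0 => /eqP.
rewrite -(fineK PN) lee_fin; apply: (@le0_geometric _ _ (b - a)) => n.
rewrite -lee_fin (fineK PN).
have NU : N `<=` \bigcup_(u in [set: n.-tuple ('I_d * bool)]) E u.
  exact: bigcap_inf.
apply: le_trans
  (content_sub_fsum P (@finite_finset _ _) (fun u _ => mE _) mN NU) _.
have le_u (u : n.-tuple ('I_d * bool)) : [set: n.-tuple _] u ->
    (P (E u) <= ((b - a) ^+ n.+1)%:E)%E.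
  by move=> _; have [_] := active_path_event y u a0 ab; rewrite size_tuple.
apply: le_trans (lee_fsum (@finite_finset _ _) le_u) _.
rewrite fsbig_finite; last exact: finite_finset.
rewrite sumEFin lee_fin big_const_seq count_predT iter_addr_0 -[leLHS]mulr_natl.
have /(ler_wpM2r _) : (size (fset_set [set: n.-tuple ('I_d * bool)]))%:R <=
    ((d * 2) ^ n)%:R :> R.
  rewrite ler_nat.
  have <- : #|{: n.-tuple ('I_d * bool)}| = ((d * 2) ^ n)%N.
    by rewrite card_tuple card_prod card_ord card_bool.
  by rewrite cardE; apply: uniq_leq_size => // u _; rewrite mem_enum.
move/(_ ((b - a) ^+ n.+1)); rewrite exprn_ge0 ?subr_ge0 ?(ltW ab) //.
move=> /(_ isT)/le_trans; apply.
rewrite exprS mulrCA ler_pM2l ?subr_gt0 // natrX -exprMn.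
by apply: lerXn2r => //; rewrite nnegrE ?mulr_ge0 ?subr_ge0 ?(ltW ab) ?invr_ge0.
Qed.

(** One null set serves all finite [X], since only countably many sites and slabs are involved. *)
Lemma ae_dependency_family (t : R) : 0 < t ->
  \forall w \ae P, forall X : set 'rV[int]_d, finite_set X ->
    exists S : R -> set 'rV[int]_d, [/\ dependency_family (clock^~ w) t S, X `<=` S t &
      finite_set (S 0)].
Proof.
(* [K] exceeds 4dt, so that slabs of length t / K satisfy the bound 2d (t / K) <= 1/2 of
   [ae_cluster_closed]. *)
move=> t0; pose K := (Num.truncn ((d * 4)%:R * t)).+1.
pose dl := t / K%:R.
have K0 : 0 < K%:R :> R by rewrite ltr0n.
have dl0 : 0 < dl by rewrite divr_gt0.
have dlK : dl *+ K = t by rewrite -mulr_natr divfK // gt_eqF.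
have ddl : (d * 2)%:R * dl <= 2^-1.
  have : (d * 4)%:R * t <= K%:R by rewrite ltW // truncnS_gt.
  rewrite /dl mulrA ler_pdivrMr //; rewrite !natrM; lra.
have : \forall w \ae P, forall (y : 'rV[int]_d) (k : nat),
    exists S : set 'rV[int]_d, [/\ finite_set S, S y &
        closed_on (active (clock^~ w) (dl *+ k) (dl *+ k.+1)) S].
  apply: ae_forall_countable => y; apply: ae_forall_countable => k.
  apply: ae_cluster_closed.
  - by rewrite mulrn_wge0 // ltW.
  - by rewrite ltr_pMn2l.
  - by rewrite mulrSr addrAC subrr add0r.
apply: filterS => w hw X Xfin; rewrite -dlK.
apply: dependency_family_slabs => //; first exact: ltW.

Qed.

End finite_clusters.

(** * Measurability of the heights *)

Lemma eq_foldl_in (X : Type) (Y : eqType) (op op' : X -> Y -> X) (l : seq Y) x :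
  (forall x y, y \in l -> op x y = op' x y) -> foldl op x l = foldl op' x l.
Proof.
elim: l x => //= y l IHl x opE; rewrite opE ?mem_head //; apply: IHl => x' y' y'l.
by apply: opE; rewrite inE y'l orbT.
Qed.

Lemma foldl_map (X Y Z : Type) (op : X -> Z -> X) (h : Y -> Z) (l : seq Y) x :
  foldl op x (map h l) = foldl (fun x y => op x (h y)) x l.
Proof. by elim: l x => /=. Qed.

(** * Discretisation of time *)

Section grid.
Context {R : realType} {d : nat}.
Variables (ring : 'rV[int]_d -> set R) (ringf : locally_finite ring).

(* The clocks are replaced by the activity in the k-th cell, whence the dummy
   ringing time 0. *)
Definition grid_height (D : {fset 'rV[int]_d}) (t : R) (K : nat) (f : config d) :
    config d :=
  foldl (fun h k => update
      (fun y => [set s : R | active ring (t / K%:R *+ k) (t / K%:R *+ k.+1) y])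
      D h 0) f (iota 0 K).

(* Once the mesh is finer than the gaps between the ringing times in D, every
   cell of the grid contains at most one of them. *)
Lemma grid_height_exact D t f : 0 < t ->
  exists N, forall K, (N < K)%N -> height_on ring D t f = grid_height D t K f.
Proof.
move=> t0; pose l := ringing_times ring D t.
(* For [K] above [N], the mesh t / K is smaller than every positive gap between ringing times. *)
pose N := (\max_(p <- [seq (s, s') | s <- l, s' <- l])
   (Num.truncn (t / (p.2 - p.1))).+1)%N.
exists N => K NK; have K0 : 0 < K%:R :> R by rewrite ltr0n (leq_trans _ NK).
pose dl := t / K%:R; have dl0 : 0 < dl by rewrite divr_gt0.
have dlK : dl *+ K = t by rewrite -mulr_natr divfK // gt_eqF.
have gap s s' : s \in l -> s' \in l -> s < s' -> dl < s' - s.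
  move=> sl s'l ss'; rewrite /dl ltr_pdivrMr // mulrC -ltr_pdivrMr ?subr_gt0 //.
  apply: lt_trans (truncnS_gt _) _; rewrite ltr_nat; apply: leq_ltn_trans NK.
  apply: (@leq_bigmax_seq _ _ xpredT
    (fun p => (Num.truncn (t / (p.2 - p.1))).+1) (s, s')) => //.
  by apply/allpairsP; exists (s, s').
pose cell s := Num.truncn (s / dl).
have cellP s : 0 <= s -> dl *+ cell s <= s < dl *+ (cell s).+1.
  move=> s0; have := truncn_itv (divr_ge0 s0 (ltW dl0)).
  by rewrite ler_pdivlMr // ltr_pdivrMr // !mulr_natl.
have cellE s k : dl *+ k <= s < dl *+ k.+1 -> cell s = k.
  move=> sk; apply: truncn_def.
  by rewrite ler_pdivlMr // ltr_pdivrMr // !mulr_natl.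
have lP s : s \in l -> 0 <= s < t by move=> /(mem_ringing_times ringf)[].
have cellK s : s \in l -> (cell s < K)%N.
  move=> /lP /andP[s0 st]; rewrite -(ltr_pMn2l dl0) dlK.
  by apply: le_lt_trans st; have /andP[] := cellP _ s0.
have cell_mono s s' : s \in l -> s' \in l -> s < s' -> (cell s < cell s')%N.
  move=> sl s'l ss'; rewrite ltnNge; apply/negP => cc.
  have /andP[s0 _] := lP _ sl; have /andP[s'0 _] := lP _ s'l.
  have /andP[h1 _] := cellP _ s0; have /andP[_ h2] := cellP _ s'0.
  have := gap _ _ sl s'l ss'; rewrite ltNge => /negP; apply.
  rewrite lerBlDr addrC (le_trans (ltW h2)) // mulrSr lerD2r.
  by apply: le_trans h1; exact: ler_wpMn2l (ltW dl0) _ _ cc.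
have lsort : sorted <%R l by exact: ringing_times_sorted.
have cell_lt s k : (k < K)%N -> dl *+ k <= s < dl *+ k.+1 -> 0 <= s < t.
  move=> kK /andP[ks sk]; rewrite (le_trans _ ks) ?mulrn_wge0 // ?(ltW dl0) //=.
  by rewrite (lt_le_trans sk) // -dlK; exact: ler_wpMn2l (ltW dl0) _ _ kK.
(* Empty cells are dropped; the remaining ones are the cells of the ringing times, in the same
   order. *)
rewrite /grid_height -(@foldl_filter_id _ _ _ (mem (map cell l))); last first.
  move=> h k; rewrite mem_iota add0n => /= kK kl.
  apply: update_id => y yD [s ys sk]; case/negP: kl; rewrite -(cellE _ _ sk).
  apply: map_f; apply/(mem_ringing_times ringf).
  by split; [exact: cell_lt sk|exists y].
have -> : [seq k <- iota 0 K | mem (map cell l) k] = map cell l.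
  apply: (irr_sorted_eq ltn_trans ltnn).
  - by apply: sorted_filter (iota_ltn_sorted _ _); exact: ltn_trans.
  - by apply: homo_sorted_in lsort; [exact: cell_mono|exact/allP].
  - move=> k; rewrite mem_filter mem_iota add0n /=.
    by case: (boolP (k \in _)) => //= /mapP[s sl ->]; exact: cellK.
rewrite foldl_map; apply: eq_foldl_in => h s sl; apply/funext => y.
rewrite /update; case yD: (y \in D) => //=.
congr (if _ then _ else _); apply/idP/idP => /set_mem.
  by move=> ys; apply/mem_set; exists s => //; apply: cellP; case/andP: (lP _ sl).
(* A ring at [y] in the cell of [s] must be [s] itself, since distinct ringing times lie in distinct
   cells. *)
move=> [s' ys' s'c]; apply/mem_set.
have s'l : s' \in l.
  apply/(mem_ringing_times ringf); split; last by exists y.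
  exact: cell_lt (cellK _ sl) s'c.
suff -> : s = s' by [].
have /cellE s'E := s'c; apply/eqP; rewrite eq_le; apply/andP.
by split; rewrite leNgt; apply/negP => /cell_mono; rewrite s'E ltnn => /(_ _ _)/=;
   [move=> /(_ s'l sl)|move=> /(_ sl s'l)].
Qed.
End grid.

(** * Measurability criteria for functions of finitely or countably many events *)

Lemma measurable_factor (disp : measure_display) (T : measurableType disp)
    (I : finType) (A : I -> set T) (Y : Type) (g : T -> Y) (B : set Y) :
  (forall i, measurable (A i)) ->
  (forall w w', (forall i, A i w <-> A i w') -> g w = g w') ->
  measurable (g @^-1` B).
Proof.
move=> mA gA; pose a w := [ffun i => `[<A i w>]].
have -> : g @^-1` B = \bigcup_(c in a @` (g @^-1` B)) (a @^-1` [set c]).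
  apply/seteqP; split=> [w Bw|w [_ [w' Bw' <-]] /= ww'].
    by exists (a w) => //; exists w.
  rewrite /preimage /= (gA w w') // => i.
  have /ffunP/(_ i) := ww'; rewrite !ffunE => E.
  by split=> h; apply/asboolP; [rewrite -E|rewrite E]; exact/asboolP.
apply: fin_bigcup_measurable => [|c _]; first exact: finite_finset.
have -> : a @^-1` [set c] = \bigcap_(i in [set: I])
    (if c i then A i else ~` A i).
  apply/seteqP; split=> [w /= <- i _|w wc]; first by rewrite ffunE; case: asboolP.
  apply/ffunP => i; rewrite ffunE; have := wc i Logic.I.
  by case: (c i) => // h; [apply/asboolP|apply/asboolPn].
apply: fin_bigcap_measurable => [|i _]; first exact: finite_finset.
by case: (c i) => //; exact: measurableC.
Qed.

Lemma measurable_preimage_countable (disp : measure_display)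
    (T : measurableType disp) (Y : countType) (g : T -> Y) (B : set Y) :
  (forall y, measurable (g @^-1` [set y])) -> measurable (g @^-1` B).
Proof.
move=> mg; have -> : g @^-1` B = \bigcup_y (if `[<B y>] then g @^-1` [set y] else set0).
  apply/seteqP; split=> [w Bw|w [y _]].
    by exists (g w) => //; rewrite asboolT.
  by case: asboolP => // By /= ->.
apply: countable_bigcupT_measurable => [|y]; first exact: countableP.
by case: asboolP.
Qed.

Lemma countable_bigcap_measurable (disp : measure_display)
    (T : measurableType disp) (I : countType) (D : set I) (F : I -> set T) :
  (forall i, measurable (F i)) -> measurable (\bigcap_(i in D) F i).
Proof.
move=> mF; rewrite -[X in measurable X]setCK setC_bigcap bigcup_mkcond.
apply: measurableC; apply: countable_bigcupT_measurable => [|i].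
  exact: countableP.
by case: ifP => // _; exact: measurableC.
Qed.

Section measurability.
Context {disp : measure_display} {T : measurableType disp} {R : realType}.
Context (P : probability T R) {d : nat} (clock : 'rV[int]_d -> T -> set R).
Hypothesis hclock : poisson_clocks P clock.
Variables (t : R) (t0 : 0 < t).

(** By [grid_height_exact] the event is the lower limit over [K] of the same event for grid heights,
    each of which depends on the activity of finitely many cells. *)
Lemma measurable_height_on D f x (B : set int) :
  measurable [set w | B (height_on (clock^~ w) D t f x)].
Proof.
pose G K w := grid_height (clock^~ w) D t K f x.
have -> : [set w | B (height_on (clock^~ w) D t f x)] =
    \bigcup_N \bigcap_(K in [set K | (N < K)%N]) (G K @^-1` B).
  apply/seteqP; split=> w.
    have [N NE] := grid_height_exact (clock_locally_finite hclock w) D f t0.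
    by move=> /= Bw; exists N => // K NK; rewrite /preimage /= /G -NE.
  have [N NE] := grid_height_exact (clock_locally_finite hclock w) D f t0.
  move=> [N' _ /(_ (maxn N N').+1)].
  by rewrite /preimage /= ltnS leq_maxr /G -NE ?ltnS ?leq_maxl //; exact.
apply: bigcupT_measurable => N; apply: bigcap_measurableType => K /= NK.
have K0 : 0 < K%:R :> R by rewrite ltr0n (leq_trans _ NK).
pose A (p : 'I_K * D) := [set w | active (clock^~ w)
  (t / K%:R *+ p.1) (t / K%:R *+ p.1.+1) (val p.2)].
apply: (measurable_factor (A := A)) => [[k y]|w w' ww'].
  apply: (measurable_active hclock).
    by rewrite mulrn_wge0 // divr_ge0 // ltW.
  by rewrite ltr_pMn2l // divr_gt0.
rewrite /G /grid_height; congr (_ x); apply: eq_foldl_in => h k.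
rewrite mem_iota add0n => /= kK; apply/funext => y.
rewrite /update; case: (boolP (y \in D)) => //= yD.
have /= E := ww' (Ordinal kK, [` yD]%fset).
by congr (if _ then _ else _); apply/idP/idP => /set_mem /E h'; apply/mem_set.
Qed.

(** Convergence in the discrete integers is eventual equality, a countable combination of events as
    there are countably many finite sets. Where the net diverges [lim] is [point], so the divergence
    event is added for that value. *)
Lemma measurable_height f x (B : set int) :
  measurable [set w | B (height (clock^~ w) t f x)].
Proof.
apply: (measurable_preimage_countable (g := fun w => height (clock^~ w) t f x)) => k.
pose h w D := height_on (clock^~ w) D t f x.
pose cvgto (k : int) w := h w @ summability.totally --> k.
have mcvg k' : measurable (cvgto k').
  have -> : cvgto k' = \bigcup_D0 \bigcap_(D in [set D | (D0 `<=` D)%fset])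
      [set w | h w D = k'].
    apply/seteqP; split=> w.
      move=> /(_ _ (discrete_set1 k'))[D0 _ D0P].
      by exists D0 => // D /= /D0P.
    move=> [D0 _ D0P]; apply: (@cvg_near_cst _ _ _ _ _ (@summability.totally_filter _)).
    by exists D0.
  apply: countable_bigcupT_measurable => [|D0]; first exact: countableP.
  apply: countable_bigcap_measurable => D.
  exact: (measurable_height_on _ _ _ [set k']).
have -> : (fun w => height (clock^~ w) t f x) @^-1` [set k] = cvgto k `|`
    (if `[<k = point>] then \bigcap_k' ~` cvgto k' else set0).
  apply/seteqP; split=> w.
    move=> /= hk; have [[k' wk']|nk] := pselect (exists k', cvgto k' w).
      left; suff -> : k = k' by [].
      rewrite -hk; apply: (@cvg_lim _ _ _ _ (summability.totally_filter)) wk'.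
      exact: discrete_hausdorff.
    right; case: (asboolP (k = point)) => [_ k' _ wk'|[]]; first by apply: nk; exists k'.
    by rewrite -hk; apply: dvgP => /cvg_ex[k' wk']; apply: nk; exists k'.
  move=> [wk|].
    apply: (@cvg_lim _ _ _ _ (summability.totally_filter)) wk.
    exact: discrete_hausdorff.
  case: (asboolP (k = point)) => // -> wk; apply: dvgP => /cvg_ex[k' wk'].
  exact: wk wk'.
apply: measurableU => //; case: (asboolP (k = point)) => // _.
by apply: countable_bigcap_measurable => k'; exact: measurableC.
Qed.

(** Finitely many integer heights take countably many joint values, so any function of them has
    measurable preimages of arbitrary sets. *)
Lemma measurable_height_factor f (s : seq 'rV[int]_d) (Y : Type) (g : T -> Y)
    (B : set Y) :
  (forall w w', (forall y, y \in s -> height (clock^~ w) t f y =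
     height (clock^~ w') t f y) -> g w = g w') ->
  measurable (g @^-1` B).
Proof.
move=> gs; pose v w := [seq height (clock^~ w) t f y | y <- s].
have -> : g @^-1` B = v @^-1` (v @` (g @^-1` B)).
  apply/seteqP; split=> [w Bw|w [w' Bw' /eq_in_map ww']]; first by exists w.
  by rewrite /preimage /= -(gs w').
apply: measurable_preimage_countable => c; rewrite /v {gs v}.
elim: s c => [|y s IHs] [|k c] /=.
- by rewrite (_ : _ @^-1` _ = setT) //; apply/seteqP; split.
- by rewrite (_ : _ @^-1` _ = set0) //; apply/seteqP; split.
- by rewrite (_ : _ @^-1` _ = set0) //; apply/seteqP; split.
- rewrite (_ : _ @^-1` _ = [set w | [set k] (height (clock^~ w) t f y)] `&`
      (fun w => [seq height (clock^~ w) t f y | y <- s]) @^-1` [set c]).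
    by apply: measurableI; [exact: measurable_height|exact: IHs].
  by apply/seteqP; split=> w /=; [move=> [-> ->]|move=> [-> ->]].
Qed.

End measurability.

(** * The Feller property *)

(** Finite windows exhausting the lattice, taken from its countable encoding. *)
Definition sites (d : nat) (n : nat) : seq 'rV[int]_d :=
  pmap (@choice.unpickle 'rV[int]_d) (iota 0 n).

Lemma fset_sub_sites (d : nat) (C : {fset 'rV[int]_d}) :
  exists N, forall n, (N <= n)%N -> {subset C <= sites d n}.
Proof.
exists (\max_(y <- C) (choice.pickle y).+1)%N => n Nn y yC.
rewrite mem_pmap; apply/mapP; exists (choice.pickle y); last first.
  by rewrite choice.pickleK.
rewrite mem_iota add0n /=; apply: leq_trans Nn.
exact: (@leq_bigmax_seq _ _ xpredT (fun y => (choice.pickle y).+1)).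
Qed.

Lemma cvg_config (d : nat) (X : Type) (F : set_system X) (FF : Filter F)
    (h : X -> config d) (f : config d) :
  (forall y, \forall n \near F, h n y = f y) -> h @ F --> f.
Proof.
move=> hf; apply/pointwise_cvgP => y A fA.
apply: filterS (hf y) => n E; rewrite /= E; exact: nbhs_singleton fA.
Qed.

Lemma nbhs_config (d : nat) (s : seq 'rV[int]_d) (f : config d) :
  nbhs f [set g | forall y, y \in s -> g y = f y].
Proof.
elim: s => [|x s IHs]; first by apply: filterS filterT => g _ y.
have /pointwise_cvgP/(_ x)/(_ _ (discrete_set1 (f x))) : {ptws, nbhs f --> f}.
  exact: cvg_id.
move=> fx; apply: filterS2 IHs fx => g gs gx y.
by rewrite inE => /orP[/eqP ->|/gs].
Qed.

Section semigroup.
Context {disp : measure_display} {T : measurableType disp} {R : realType}.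
Context (P : probability T R) {d : nat} (clock : 'rV[int]_d -> T -> set R).
Hypothesis hclock : poisson_clocks P clock.
Variables (t : R) (t0 : 0 < t).

Definition profile (f : config d) (w : T) : config d :=
  let h := height (clock^~ w) t f in fun x => h x - h 0.

(** Almost surely the infinite-volume height at [x] equals the one computed on the finite set [S 0].
    Neither the null set nor [C] depends on the initial condition. *)
Lemma ae_height_local : \forall w \ae P, forall x : 'rV[int]_d,
  (exists C : {fset 'rV[int]_d}, forall f g : config d,
     (forall y, y \in C -> f y = g y) ->
     height (clock^~ w) t f x = height (clock^~ w) t g x) /\
  (forall f, f x <= height (clock^~ w) t f x).
Proof.
apply: filterS (ae_dependency_family hclock t0) => w hw x.
have [S [Sdep xS S0]] := hw [set x] (finite_set1 x).
have Sx : S t x by exact: xS.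
have lf := clock_locally_finite hclock w.
have SC y : S 0 y <-> y \in fset_set (S 0).
  by rewrite in_fset_set //; split=> [/mem_set|/set_mem].
have hE f : height (clock^~ w) t f x =
    height_on (clock^~ w) (fset_set (S 0)) t f x.
  by apply: (height_near lf) Sdep _ _ _ => //; [exact: ltW|move=> z /SC].
split=> [|f]; last by rewrite hE; exact: foldl_update_ge.
exists (fset_set (S 0)) => f g fg; rewrite !hE.
by apply: (height_on_agree lf) Sdep _ _ _ _ Sx => //; [exact: ltW|move=> z /SC/fg].
Qed.

(** The profile cut off outside a finite window depends on finitely many heights; continuity of
    [Phi] passes to the limit as the windows grow. *)
Lemma measurable_profile (Phi : config d -> R) (f : config d) :
  continuous Phi -> measurable_fun [set: T] (Phi \o profile f).
Proof.
move=> cPhi.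
pose X n w : config d := fun x => if x \in sites d n then profile f w x else 0.
apply: (@measurable_fun_cvg _ _ _ _ (fun n => Phi \o X n)).
  move=> n _ B mB; rewrite setTI.
  (* The origin is added to the window because its height is subtracted everywhere. *)
  apply: (measurable_height_factor hclock t0 (f := f) (s := 0 :: sites d n)).
  move=> w w' ww' /=; congr Phi; apply/funext => x; rewrite /X.
  case: ifPn => // xs; rewrite /profile (ww' 0) ?mem_head // (ww' x) //.
  by rewrite inE xs orbT.
move=> w _; apply: (@cvg_comp _ _ _ (fun n => X n w) Phi) (cPhi _).
apply: cvg_config => y; have [N NP] := fset_sub_sites [fset y]%fset.
by exists N => // n Nn /=; rewrite /X NP // inE.
Qed.

Lemma bd_semigroupE (Phi : config d -> R) f :
  bd_semigroup P clock t Phi f = fine (\int[P]_w (Phi (profile f w))%:E).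
Proof. by rewrite /bd_semigroup unlock. Qed.

Lemma integrable_profile (Phi : config d -> R) (M : R) (f : config d) :
  continuous Phi -> (forall g, `|Phi g| <= M) ->
  P.-integrable [set: T] (fun w => (Phi (profile f w))%:E).
Proof.
move=> cPhi PhiM; apply: (@le_integrable _ _ _ P _ measurableT _ (cst M%:E)).
- by apply/measurable_EFinP; exact: measurable_profile.
- move=> w _ /=; rewrite lee_fin (le_trans (PhiM _)) // ler_norm //.
- exact: finite_measure_integrable_cst.
Qed.

Lemma bd_semigroup_bounded (Phi : config d -> R) (M : R) (f : config d) :
  continuous Phi -> (forall g, `|Phi g| <= M) ->
  `|bd_semigroup P clock t Phi f| <= M.
Proof.
move=> cPhi PhiM; have iPhi := integrable_profile f cPhi PhiM.
rewrite bd_semigroupE; have fin := integrable_fin_num measurableT iPhi.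
rewrite -fine_abse // -lee_fin fineK ?abse_fin_num //.
apply: le_trans (le_abse_integral _ measurableT _) _.
  by apply/measurable_EFinP; exact: measurable_profile.
rewrite -[leRHS]mule1 -(probability_setT P) -integral_cst //.
apply: ge0_le_integral => //.
- by apply: measurableT_comp => //; apply/measurable_EFinP; exact: measurable_profile.
- by move=> w _; rewrite lee_fin.
Qed.

Lemma bd_semigroup_continuous (Phi : config d -> R) (M : R) :
  continuous Phi -> (forall g, `|Phi g| <= M) ->
  continuous (bd_semigroup P clock t Phi).
Proof.
move=> cPhi PhiM f0; apply/cvgrPdist_le => /= e e0.
apply: contrapT => nf.
(* If continuity fails at [f0], the neighbourhoods given by agreement on growing windows yield a bad
   sequence converging to [f0], to which dominated convergence applies. *)
have /choice[f_ f_P] : forall n, exists f : config d,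
    (forall y, y \in sites d n -> f y = f0 y) /\
    e < `|bd_semigroup P clock t Phi f0 - bd_semigroup P clock t Phi f|.
  move=> n; apply: contrapT => nE; apply: nf.
  apply: filterS (nbhs_config (sites d n) f0) => f ff0.
  by rewrite leNgt; apply/negP => ef; apply: nE; exists f.
have [||||| _ _ cv] := @dominated_convergence _ _ _ P _ measurableT
  (fun n w => (Phi (profile (f_ n) w))%:E) (fun w => (Phi (profile f0 w))%:E)
  (cst M%:E).
- by move=> n; apply/measurable_EFinP; exact: measurable_profile.
- by apply/measurable_EFinP; exact: measurable_profile.
- apply: filterS ae_height_local => w hw _.
  apply: (cvg_comp _ _ _ (@cvg_id _ (nbhs (Phi (profile f0 w))%:E))).
  apply: cvg_EFin; first exact: nearW.
  apply: (@cvg_comp _ _ _ (fun n => profile (f_ n) w) Phi) (cPhi _).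
  (* Once the window contains the finite set [C] on which the height at [y] depends, the two heights
     coincide. *)
  have hE y : \forall n \near \oo,
      height (clock^~ w) t (f_ n) y = height (clock^~ w) t f0 y.
    have [[C CP] _] := hw y; have [N NP] := fset_sub_sites C.
    by exists N => // n /= /NP Cn; apply: CP => z /Cn /(f_P n).1.
  apply: cvg_config => y; apply: filterS2 (hE y) (hE 0) => n.
  by rewrite /profile => -> ->.
- exact: finite_measure_integrable_cst.
- by apply: aeW => w n _; rewrite lee_fin.
have fin := integrable_fin_num measurableT (integrable_profile f0 cPhi PhiM).
rewrite -(fineK fin) -bd_semigroupE in cv.
have : (fun n => bd_semigroup P clock t Phi (f_ n)) @ \oo -->
    bd_semigroup P clock t Phi f0.
  by under eq_fun do rewrite bd_semigroupE; exact: fine_cvg cv.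
move=> /cvgrPdist_le/(_ e e0)[N _ /(_ N (leqnn N))].
by rewrite /= leNgt (f_P N).2.
Qed.

Lemma bd_semigroup_feller (Phi : config d -> R) :
  bounded_fun Phi -> continuous Phi ->
  bounded_fun (bd_semigroup P clock t Phi) /\
  continuous (bd_semigroup P clock t Phi).
Proof.
move=> bPhi cPhi.
have [M PhiM] := (@ex_bound _ _ _ Phi _ (globally_properfilter (a := point) I)).1 bPhi.
have {}PhiM g : `|Phi g| <= M by exact: PhiM.
split; last exact: bd_semigroup_continuous cPhi PhiM.
apply: (@ex_bound _ _ _ _ _ (globally_properfilter (a := point) I)).2.
by exists M => f _; exact: bd_semigroup_bounded.
Qed.
End semigroup.

(** * Failure of the strong Feller property *)

Section not_strongly_feller.
Context {disp : measure_display} {T : measurableType disp} {R : realType}.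
Context (P : probability T R) {d : nat} (clock : 'rV[int]_d -> T -> set R).
Hypothesis hclock : poisson_clocks P clock.
Variables (t : R) (t0 : 0 < t) (i0 : 'I_d).

Definition diag (k : nat) : 'rV[int]_d := const_mx k%:Z.

Definition eventually_above (M : nat -> nat) : set (config d) :=
  \bigcup_N \bigcap_(k in [set k | (N <= k)%N]) [set g | (M k)%:Z <= g (diag k)].

Lemma borel_eventually_above (M : nat -> nat) :
  borel_measurable (\1_(eventually_above M) : config d -> R).
Proof.
apply: measurable_indic; apply: bigcupT_measurable => N.
apply: bigcap_measurableType => k _; apply: sub_sigma_algebra.
rewrite /= openE => g /= gM; apply: filterS (nbhs_config [:: diag k] g) => g' /= E.
by rewrite (E (diag k)) ?mem_head.
Qed.

Lemma measurable_profile_above (M : nat -> nat) (f : config d) :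
  measurable (profile clock t f @^-1` eventually_above M).
Proof.
rewrite preimage_bigcup; apply: bigcupT_measurable => N.
rewrite preimage_bigcap; apply: bigcap_measurableType => k _.
apply: (measurable_height_factor hclock t0 (f := f) (s := [:: 0; diag k])
  (g := fun w => profile clock t f w (diag k)) [set z | (M k)%:Z <= z]).
by move=> w w' ww'; rewrite /profile !ww' // !inE eqxx ?orbT.
Qed.

Lemma bd_semigroup_above (M : nat -> nat) (f : config d) :
  bd_semigroup P clock t (\1_(eventually_above M)) f =
  fine (P (profile clock t f @^-1` eventually_above M)).
Proof.
rewrite bd_semigroupE -(setIT (_ @^-1` _)) -integral_indic //.
exact: measurable_profile_above.
Qed.

(** Continuity from above: [height] is always an integer, so these events decrease to the empty
    set. *)
Lemma height_tail (f : config d) (x : 'rV[int]_d) (e : R) : 0 < e ->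
  exists m : nat, (P [set w | (m%:Z <= height (clock^~ w) t f x)%R] <= e%:E)%E.
Proof.
move=> e0; pose A m := [set w | m%:Z <= height (clock^~ w) t f x].
have mA m : measurable (A m).
  exact: (measurable_height hclock t0 f x [set z | m%:Z <= z]).
have A0 : \bigcap_m A m = set0.
  rewrite -subset0 => w /(_ (`|height (clock^~ w) t f x|.+1) I).
  by rewrite /A /=; lia.
have /fine_cvgP[_ /cvgrPdist_le/(_ e e0)[m _ /(_ m (leqnn m))]] :
    P \o A @ \oo --> (0%R)%:E.
  rewrite -[X in _ --> X](measure0 P) -A0; apply: nonincreasing_cvg_mu => //.
  - by rewrite -ge0_fin_numE // fin_num_measure.
  - exact: bigcapT_measurable.
  - move=> m n mn; apply/subsetPset => w; apply: le_trans.
    by rewrite lez_nat.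
rewrite /= sub0r normrN => h; exists m.
rewrite -(fineK (fin_num_measure P _ (mA m))) lee_fin.
exact: le_trans (ler_norm _) h.
Qed.

(** Coordinate [i0] identifies the only possible [k] with [y = diag k]. The surplus [k] absorbs the
    random height at the origin, subtracted in the profile. *)
Definition tall (M : nat -> nat) (n : nat) : config d := fun y =>
  let k := `|y ord0 i0|%N in
  if (n <= k)%N && (y == diag k) then (M k + k)%:Z else 0.

Lemma tall_diag M n k : (n <= k)%N -> tall M n (diag k) = (M k + k)%:Z.
Proof. by rewrite /tall mxE absz_nat => ->; rewrite eqxx. Qed.

Lemma cvg_tall M : tall M @ \oo --> ((fun=> 0) : config d).
Proof.
apply: cvg_config => y; exists (`|y ord0 i0|.+1)%N => // n /= yn.
by rewrite /tall leqNgt yn.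
Qed.

Lemma bd_semigroup_tall M n :
  bd_semigroup P clock t (\1_(eventually_above M)) (tall M n) = 1.
Proof.
rewrite bd_semigroup_above; set A := _ @^-1` _.
have mA : measurable A by exact: measurable_profile_above.
suff /negligibleP PA : P.-negligible (~` A).
  have := probability_setC P (measurableC mA).
  by rewrite setCK PA ?sube0 => [->//|]; exact: measurableC.
apply: filterS (ae_height_local hclock t0) => w hw.
pose h := height (clock^~ w) t (tall M n).
(* For such [k], monotonicity in time gives h (diag k) >= M k + k >= M k + h 0. *)
exists (maxn n `|h 0|) => // k /=; rewrite geq_max => /andP[nk hk].
rewrite /profile -/h; have := (hw (diag k)).2 (tall M n).
by rewrite tall_diag // -/h; lia.
Qed.

Lemma bd_semigroup_flat (M : nat -> nat) :
  (forall k, (P [set w | ((M k)%:Z <= height (clock^~ w) t (fun=> 0) (diag k))%R]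
     <= (2^-1 ^+ k)%:E)%E) ->
  bd_semigroup P clock t (\1_(eventually_above M)) (fun=> 0) = 0.
Proof.
move=> MP; rewrite bd_semigroup_above; set A := _ @^-1` _.
have mA : measurable A by exact: measurable_profile_above.
suff /(negligibleP P mA) -> : P.-negligible A by [].
pose B k := [set w | (M k)%:Z <= height (clock^~ w) t (fun=> 0) (diag k)].
have mB k : measurable (B k).
  exact: (measurable_height hclock t0 _ _ [set z | (M k)%:Z <= z]).
have mBN N : measurable (\bigcap_(k in [set k | (N <= k)%N]) B k).
  exact: bigcap_measurableType.
have BN N : P.-negligible (\bigcap_(k in [set k | (N <= k)%N]) B k).
  apply/negligibleP => //; have fin := fin_num_measure P _ (mBN N).
  apply/eqP; suff : (P (\bigcap_(k in [set k | (N <= k)%N]) B k) <= 0)%E.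
    by rewrite measure_le0.
  rewrite -(fineK fin) lee_fin; apply: (@le0_geometric _ _ 1) => n.
  rewrite -lee_fin (fineK fin) mul1r.
  (* The intersection lies in each single [B (n + N)], whose probability is at most 2^-(n + N). *)
  apply: le_trans (_ : P (B (n + N)%N) <= _)%E.
    apply: le_measure; rewrite ?inE //.
    by apply: bigcap_inf => /=; rewrite leq_addl.
  apply: le_trans (MP _) _; rewrite lee_fin.
  by rewrite ler_wiXn2l ?invr_ge0 ?invf_le1 ?ler1n ?leq_addr.
have N0 : P.-negligible _ := ae_height_local hclock t0.
apply: (negligibleS _ (negligibleU N0 (negligible_bigcup BN))) => w [N _ wN].
apply: contrapT => /not_orP[/contrapT hw]; apply; exists N => // k Nk.
(* Started flat, the height at the origin stays nonnegative, so a profile above [M k] forces a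
   height above [M k]. *)
have := wN k Nk; have := (hw 0).2 (fun=> 0); rewrite /B /= /profile; lia.
Qed.

Lemma bd_semigroup_not_strongly_feller :
  ~ strongly_feller (bd_semigroup P clock).
Proof.
have e0 k : 0 < 2^-1 ^+ k :> R by rewrite exprn_gt0.
have /choice[M MP] k := height_tail (fun=> 0) (diag k) (e0 k).
move=> /(_ (\1_(eventually_above M)) t t0)[||_ cQ].
- apply: (@ex_bound _ _ _ _ _ (globally_properfilter (a := point) I)).2.
  exists 1 => f _ /=; rewrite indicE; case: (_ \in _) => /=.
    by rewrite normr1.
  by rewrite normr0.
- exact: borel_eventually_above.
(* Continuity at the flat configuration would make the constant values 1 along [tall M n] converge
   to 0. *)
have := cvg_comp _ _ (cvg_tall M) (cQ (fun=> 0)).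
rewrite bd_semigroup_flat //.
rewrite (_ : _ \o _ = cst 1); last by apply/funext => n; exact: bd_semigroup_tall.
move=> /(cvg_lim (@Rhausdorff R)); rewrite lim_cst; last exact: Rhausdorff.
by move=> /eqP; rewrite oner_eq0.
Qed.

End not_strongly_feller.

Theorem theorem1p5 (R : realType) (d : nat) (hd : (1 <= d)%N)
    (disp : measure_display) (T : measurableType disp) (P : probability T R)
    (clock : 'rV[int]_d -> T -> set R) (hclock : poisson_clocks P clock) :
  feller (bd_semigroup P clock) /\
  ~ strongly_feller (bd_semigroup P clock).
Proof.
(* The failure is exhibited at time 1; [hd] supplies a coordinate index. *)
split; last exact: (bd_semigroup_not_strongly_feller hclock ltr01 (Ordinal hd)).
by move=> Phi t t0; exact: bd_semigroup_feller.
Qed.
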